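(* Let $I\subseteq\mathbb{R}$ be an interval and let $f:I\to\mathbb{R}$ be absolutely continuous on $I^{\circ}$, the interior of $I$. Let $a,b\in I^{\circ}$ with $a<b$, and suppose $f'\in L[a,b]$. If $$f(a)=\max_{a\le x\le b} f(x)=f(b)\quad\text{and}\quad \int_a^b f(t)\,dt=0,$$ then $$\max_{a\le x\le b} f(x)^2\le \frac{b-a}{12}\int_a^b f'(x)^2\,dx .$$ Moreover, the constant $\frac{b-a}{12}$ is best possible (it cannot be replaced by a smaller constant such that the inequality remains valid for all functions satisfying the hypotheses).
   Context: $L[a,b]$ denotes the space of Lebesgue integrable functions on $[a,b]$. *)

(* Defs.v *)
From HB Require Import structures.
From mathcomp Require Import all_boot all_order all_algebra.
From mathcomp Require Import all_classical all_reals all_analysis.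
Set Implicit Arguments. Unset Strict Implicit. Unset Printing Implicit Defensive.
Import Order.TTheory GRing.Theory Num.Theory.
Import numFieldNormedType.Exports.
Local Open Scope classical_set_scope.
Local Open Scope ring_scope.

Definition abs_continuous_on (R : realType) (D : set R) (f : R -> R) : Prop :=
  forall eps : R, 0 < eps -> exists2 delta : R, 0 < delta &
    forall (n : nat) (u v : 'I_n -> R),
      (forall k, u k <= v k) ->
      (forall k, D (u k) /\ D (v k)) ->
      (forall k l, k != l -> (v k <= u l) \/ (v l <= u k)) ->
      \sum_(k < n) (v k - u k) < delta ->
      \sum_(k < n) `|f (v k) - f (u k)| < eps.

(* Main.v *)
Require Import Defs.
From HB Require Import structures.
From mathcomp Require Import all_boot all_order all_algebra.
From mathcomp Require Import all_classical all_reals all_analysis.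
From mathcomp Require Import measurable_realfun.
From mathcomp Require Import ring lra.
Import Order.TTheory GRing.Theory Num.Theory.
Import numFieldNormedType.Exports.
Local Open Scope classical_set_scope.
Local Open Scope ring_scope.

(** An absolutely continuous f on [a, b] is a difference of two nondecreasing
absolutely continuous functions (its total variation V and V - f). The
Lebesgue-Stieltjes measure of such a function is dominated by the Lebesgue
measure, so Radon-Nikodym and Lebesgue differentiation give the fundamental
theorem of calculus: f' exists almost everywhere and f b - f a is its integral.

For the inequality, put L = b - a, let p t = t - x + L/2 on [a, x] and
p t = t - x - L/2 on [x, b] (the first Bernoulli polynomial of the circle
[a, b] / (a = b)). Integration by parts turns f a = f b and the vanishing of the
mean of f into "integral of f' p = L f x", while p^2 has integral L^3/12. The
bound is Cauchy-Schwarz: integrate (f' - lam p)^2 >= 0 with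
lam = 12 (f x) / L^2.

Equality holds for f' = p with x = a, i.e. for a parabola centred at the
midpoint of [a, b]. *)

(** * Families of nonoverlapping segments *)

Section segments.
Set Implicit Arguments.
Unset Strict Implicit.
Context {R : realType}.
Implicit Types (D : set R) (f : R -> R) (l : seq (R * R)).

Definition nonoverlapping (p q : R * R) := (p.2 <= q.1) || (q.2 <= p.1).

(** Finite families are kept as lists so that one segment can be traded for many by concatenation.
    Common endpoints are allowed, as in [abs_continuous_on]. *)
Definition segments D l :=
  [/\ {in l, forall p, p.1 <= p.2}, {in l, forall p, D p.1 /\ D p.2} &
      pairwise nonoverlapping l].

Definition total_length l := \sum_(p <- l) (p.2 - p.1).

Definition sumvar f l := \sum_(p <- l) `|f p.2 - f p.1|.

Lemma abs_continuous_on_segments D f eps : abs_continuous_on D f -> 0 < eps ->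
  exists2 delta, 0 < delta &
    forall l, segments D l -> total_length l < delta -> sumvar f l < eps.
Proof.
move=> /[apply] -[d d0 H]; exists d => // l [l1 l2 l3] ld.
pose t := in_tuple l; rewrite /sumvar big_tnth.
apply: (H (size l) (fun k => (tnth t k).1) (fun k => (tnth t k).2)) => //.
- by move=> k; apply: l1; exact: mem_tnth.
- by move=> k; apply: l2; exact: mem_tnth.
- move=> i j ij.
  suff /orP[h|h] : nonoverlapping (tnth t i) (tnth t j) by [left|right].
  rewrite !(tnth_nth (0, 0)) /=.
  have {}l3 := pairwiseP (0, 0) l3.
  have sym p q : nonoverlapping p q -> nonoverlapping q p.
    by rewrite /nonoverlapping orbC.
  by move: ij; rewrite neq_ltn => /orP[ij|ij]; [|apply: sym];
    apply: l3 => //; rewrite inE /=.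
- by move: ld; rewrite /total_length big_tnth.
Qed.

(** The weak bound [<= eps] is enough, since it can be used at half of the given value. It is the
    form that a supremum over partitions delivers. *)
Lemma segments_abs_continuous_on D f :
  (forall eps, 0 < eps -> exists2 delta, 0 < delta &
    forall l, segments D l -> total_length l < delta -> sumvar f l <= eps) ->
  abs_continuous_on D f.
Proof.
move=> H e e0; have [d d0 {}H] := H _ (divr_gt0 e0 (ltr0Sn R 1)).
exists d => // n u v uv Duv no ld.
pose l := [seq (u k, v k) | k <- index_enum 'I_n].
have := H l; rewrite /sumvar /total_length /l !big_map /= => He.
have {}He := fun x => He x ld; apply: (@le_lt_trans _ _ (e / 2)); last first.
  by rewrite ltr_pdivrMr// ltr_pMr// ltr1n.
apply: He; split.
- by move=> p /mapP[k _ ->]; exact: uv.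
- by move=> p /mapP[k _ ->]; exact: Duv.
- rewrite pairwise_map; apply: (@sub_in_pairwise _ predT (fun i j => i != j)).
  + by move=> i j _ _ /= /no => -[] h; rewrite /nonoverlapping/= h ?orbT.
  + exact/allP.
  + by rewrite -uniq_pairwise index_enum_uniq.
Qed.

Lemma segments_catr D l1 l2 : segments D (l1 ++ l2) -> segments D l2.
Proof.
move=> [H1 H2 H3]; split; last by move: H3; rewrite pairwise_cat => /and3P[].
- by move=> p pl; apply: H1; rewrite mem_cat pl orbT.
- by move=> p pl; apply: H2; rewrite mem_cat pl orbT.
Qed.

Lemma total_length_cat l1 l2 :
  total_length (l1 ++ l2) = total_length l1 + total_length l2.
Proof. exact: big_cat. Qed.

Lemma sumvar_cat f l1 l2 : sumvar f (l1 ++ l2) = sumvar f l1 + sumvar f l2.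
Proof. exact: big_cat. Qed.

Lemma sumvar_ge0 f l : 0 <= sumvar f l.
Proof. exact: sumr_ge0. Qed.

Definition steps (a : R) (s : seq R) := zip (a :: s) s.

Arguments steps : simpl never.

Lemma steps_cons a x s : steps a (x :: s) = (a, x) :: steps x s.
Proof. by []. Qed.

Lemma mem_steps a s p : path <%O a s -> p \in steps a s ->
  [/\ a <= p.1, p.1 <= p.2 & p.2 <= last a s].
Proof.
elim: s a => // x s IH a /= /andP[ax xs].
have xl : x <= last x s by apply: (@itv_partition_le _ _ _ _ s); split.
rewrite steps_cons inE => /orP[/eqP -> //=|/(IH _ xs)[h1 h2 h3]].
  by split => //; exact: ltW.
by split => //; rewrite (le_trans (ltW ax)).
Qed.

Lemma pairwise_steps a s : path <%O a s -> pairwise nonoverlapping (steps a s).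
Proof.
elim: s a => // x s IH a; rewrite steps_cons /= => /andP[ax xs].
rewrite IH// andbT.
by apply/allP => p /(mem_steps xs)[xp _ _]; rewrite /nonoverlapping/= xp.
Qed.

Lemma total_length_steps a s : total_length (steps a s) = last a s - a.
Proof.
elim: s a => [|x s IH] a; first by rewrite /total_length big_nil subrr.
by rewrite steps_cons /total_length big_cons -/(total_length _) IH/=
   addrC addrA subrK.
Qed.

Lemma variation_steps a b f s : itv_partition a b s ->
  variation a b f s = sumvar f (steps a s).
Proof.
move=> /variation_zip ->; rewrite /sumvar /steps.
elim: s a => [|x s IH] a; first by rewrite !big_nil.
by rewrite /= !big_cons IH.
Qed.

(** Every step lies inside [u, v]: it stays in [D] by convexity, and it avoids whatever [u, v]
    avoids. *)
Lemma segments_refine D u v s l1 l2 : is_interval D ->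
  itv_partition u v s -> segments D ((u, v) :: l1 ++ l2) ->
  segments D (l1 ++ steps u s ++ l2).
Proof.
move=> iD [us /eqP uv] [H1 H2 H3].
have sub p : p \in steps u s -> [/\ u <= p.1, p.1 <= p.2 & p.2 <= v].
  by move=> /(mem_steps us); rewrite uv.
have [/= Du Dv] := H2 (u, v) (mem_head _ _).
have memD x : u <= x <= v -> D x by exact: iD.
have cases p : p \in l1 ++ steps u s ++ l2 ->
    p \in (u, v) :: l1 ++ l2 \/ p \in steps u s.
  by rewrite inE !mem_cat => /or3P[->|->|->]; rewrite ?orbT; auto.
split.
- by move=> p /cases[/H1//|/sub[]].
- move=> p /cases[/H2//|/sub[h1 h2 h3]]; split; apply: memD.
  + by rewrite h1 (le_trans h2).
  + by rewrite h3 (le_trans h1).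
- move: H3; rewrite /= !pairwise_cat all_cat.
  move=> /andP[/andP[/allP u1 /allP u2] /and3P[/allrelP a12 p1 p2]].
  rewrite allrel_catr p1 p2 pairwise_steps// !andbT.
  have ov p q : p \in steps u s -> nonoverlapping (u, v) q ->
      nonoverlapping p q.
    move=> /sub[up _ pv] /orP[]/= h; rewrite /nonoverlapping.
      by rewrite (le_trans pv).
    by rewrite (le_trans h) ?orbT.
  rewrite -andbA; apply/and3P; split.
  + apply/allrelP => p q /u1 pu /ov => /(_ p pu).
    by rewrite /nonoverlapping orbC.
  + exact/allrelP.
  + by apply/allrelP => p q /ov pq /u2 /pq.
Qed.

(* By induction on l1: a segment of l1 is traded for the steps of one of its
   partitions, put into l2, and its total variation is the supremum over them. *)
Lemma le_sum_total_variation D f delta eps : is_interval D ->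
  (forall l, segments D l -> total_length l < delta -> sumvar f l <= eps) ->
  forall l1 l2, segments D (l1 ++ l2) -> total_length (l1 ++ l2) < delta ->
  (\sum_(p <- l1) total_variation p.1 p.2 f + (sumvar f l2)%:E <= eps%:E)%E.
Proof.
move=> iD H; elim => [|[u v] l1 IH] l2.
  by rewrite big_nil add0e lee_fin; exact: H.
rewrite cat_cons => sl ll; rewrite big_cons /=.
have uv : u <= v by have [/(_ (u, v) (mem_head _ _))] := sl.
have sl' : segments D (l1 ++ l2) by apply: (@segments_catr _ [:: (u, v)]).
set rest := (\sum_(p <- l1) _)%E.
have rest0 : (0 <= rest)%E.
  rewrite /rest big_seq_cond; apply: sume_ge0 => p /andP[pl _].
  by apply: total_variation_ge0; case: sl' => h _ _; apply: h; rewrite mem_cat pl.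
(* Without (u, v) the bound already holds, so the remaining terms are finite and may be subtracted
   in the extended reals. *)
have restle : (rest + (sumvar f l2)%:E <= eps%:E)%E.
  apply: IH => //; apply: le_lt_trans ll.
  rewrite /total_length big_cons lerDr subr_ge0//.
rewrite -addeA -leeBrDr; last first.
  rewrite ge0_fin_numE; first exact: le_lt_trans restle (ltry _).
  by rewrite adde_ge0// lee_fin sumvar_ge0.
apply: ge_ereal_sup => _ [_ [s us <-] <-].
rewrite leeBrDr; last first.
  rewrite ge0_fin_numE; first exact: le_lt_trans restle (ltry _).
  by rewrite adde_ge0// lee_fin sumvar_ge0.
rewrite addeCA -EFinD variation_steps// -sumvar_cat.
apply: IH; first exact: segments_refine sl.
rewrite !total_length_cat total_length_steps; have [_ /eqP ->] := us.
by move: ll; rewrite /total_length big_cons/= big_cat/= addrCA.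
Qed.

End segments.

(** * Absolutely continuous functions *)

Section ac_closure.
Set Implicit Arguments.
Unset Strict Implicit.
Context {R : realType}.
Implicit Types (D : set R) (f g h : R -> R).

Lemma abs_continuous_onS D E f : D `<=` E ->
  abs_continuous_on E f -> abs_continuous_on D f.
Proof.
move=> DE acf e e0; have [d d0 H] := acf e e0; exists d => // n u v uv Duv.
by apply: H => // k; have [/DE ? /DE ?] := Duv k.
Qed.

(** Common source of the closure properties: Lipschitz functions, differences and products all
    reduce to such a bound on increments. *)
Lemma abs_continuous_on_dominated D f g h K M : 0 <= K -> 0 <= M ->
  abs_continuous_on D f -> abs_continuous_on D g ->
  (forall x y, D x -> D y ->
    `|h y - h x| <= K * `|f y - f x| + M * `|g y - g x|) ->
  abs_continuous_on D h.
Proof.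
(* The extra 1 keeps the denominator positive when [K] and [M] vanish and makes the final inequality
   strict. *)
move=> K0 M0 acf acg fgh e e0; pose e' := e / (K + M + 1).
have KM : 0 < K + M + 1 by rewrite ltr_wpDl// addr_ge0.
have e'0 : 0 < e' by rewrite divr_gt0.
have [d1 d10 H1] := acf e' e'0; have [d2 d20 H2] := acg e' e'0.
exists (Num.min d1 d2); first by rewrite lt_min d10.
move=> n u v uv Duv no; rewrite lt_min => /andP[ld1 ld2].
have {}H1 := H1 n u v uv Duv no ld1; have {}H2 := H2 n u v uv Duv no ld2.
apply: (@le_lt_trans _ _ (K * e' + M * e')).
  apply: (@le_trans _ _ (K * \sum_(k < n) `|f (v k) - f (u k)| +
                         M * \sum_(k < n) `|g (v k) - g (u k)|)).
    rewrite !mulr_sumr -big_split; apply: ler_sum => k _.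
    by have [? ?] := Duv k; exact: fgh.
  by apply: lerD; apply: ler_wpM2l => //; exact: ltW.
rewrite -mulrDl mulrC mulrAC ltr_pdivrMr// ltr_pM2l// ltrDl//.
Qed.

Lemma abs_continuous_on_id D : abs_continuous_on D id.
Proof.
move=> e e0; exists e => // n u v uv _ _.
by rewrite [X in _ -> X < _](eq_bigr (fun k => v k - u k))// => k _;
  rewrite ger0_norm// subr_ge0.
Qed.

Lemma abs_continuous_on_lipschitz D f K : 0 <= K ->
  (forall x y, D x -> D y -> `|f y - f x| <= K * `|y - x|) ->
  abs_continuous_on D f.
Proof.
move=> K0 Kf.
apply: (@abs_continuous_on_dominated D id id f K 0) => //;
  [exact: abs_continuous_on_id..|].
by move=> x y Dx Dy; rewrite mul0r addr0 Kf.
Qed.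

Lemma abs_continuous_on_cst D (c : R) : abs_continuous_on D (cst c).
Proof.
by apply: (@abs_continuous_on_lipschitz _ _ 0) => // x y _ _;
  rewrite subrr normr0 mul0r.
Qed.

Lemma abs_continuous_onB D f g : abs_continuous_on D f ->
  abs_continuous_on D g -> abs_continuous_on D (f \- g).
Proof.
move=> acf acg.
apply: (abs_continuous_on_dominated ler01 ler01 acf acg) => x y _ _.
rewrite !mul1r /= -normrN; apply: le_trans (ler_normB _ _).
rewrite -(normrN (_ - _)) le_eqVlt; apply/orP; left; apply/eqP.
by congr `|_|; ring.
Qed.

Lemma abs_continuous_onM D f g M : 
  (forall x, D x -> `|f x| <= M) -> (forall x, D x -> `|g x| <= M) ->
  abs_continuous_on D f ->
  abs_continuous_on D g -> abs_continuous_on D (f \* g).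
Proof.
move=> fM gM acf acg.
(* A point of [D] shows that [M] is nonnegative; over an empty [D] only the empty family exists. *)
have [[z Dz]|D0] := pselect (D !=set0); last first.
  move=> e e0; exists 1 => // -[|n] u v _ Duv.
    by rewrite !big_ord0.
  by exfalso; apply: D0; exists (u ord0); have [] := Duv ord0.
have M0 : 0 <= M by apply: le_trans (fM _ Dz).
apply: (abs_continuous_on_dominated M0 M0 acf acg) => x y Dx Dy /=.
have -> : f y * g y - f x * g x = g y * (f y - f x) + f x * (g y - g x) by ring.
apply: (le_trans (ler_normD _ _)); rewrite !normrM.
by apply: lerD; apply: ler_wpM2r => //; [exact: gM|exact: fM].
Qed.

(** For [a <= b], this is the retraction of the line onto [a, b]. Composing with it extends a
    function by constants, as needed for Stieltjes measures, which live on the whole line. *)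
Definition clamp (a b x : R) := Num.max a (Num.min x b).

Lemma clamp_itv a b x : a <= b -> clamp a b x \in `[a, b].
Proof.
by move=> ab; rewrite in_itv/= /clamp le_max lexx/= ge_max ab ge_min lexx orbT.
Qed.

Lemma clamp_id a b x : x \in `[a, b] -> clamp a b x = x.
Proof.
by rewrite in_itv/= /clamp => /andP[ax xb]; rewrite (min_idPl xb) (max_idPr ax).
Qed.

Lemma clamp_le a b x y : x <= y -> clamp a b x <= clamp a b y.
Proof.
move=> xy; rewrite /clamp ge_max le_max lexx/= le_max; apply/orP; right.
by rewrite le_min !ge_min xy lexx orbT.
Qed.

Lemma clamp_dist a b x y : x <= y -> clamp a b y - clamp a b x <= y - x.
Proof.
rewrite /clamp /Num.max /Num.min /Order.max /Order.min => xy.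
by repeat case: ifPn; rewrite -?leNgt => *; lra.
Qed.

(** [clamp] is monotone and does not increase distances, so it maps a nonoverlapping family to a
    nonoverlapping family of no greater length. *)
Lemma abs_continuous_on_clamp a b f : a <= b -> abs_continuous_on `[a, b] f ->
  abs_continuous_on setT (f \o clamp a b).
Proof.
move=> ab acf e e0; have [d d0 H] := acf e e0.
exists d => // n u v uv _ no ld.
apply: (H n (clamp a b \o u) (clamp a b \o v)).
- by move=> k; exact: clamp_le.
- by move=> k; split; exact: clamp_itv.
- by move=> k l /no[] h; [left|right]; exact: clamp_le.
- apply: le_lt_trans ld; apply: ler_sum => k _; exact: clamp_dist.
Qed.

Lemma abs_continuous_onT_continuous f : abs_continuous_on setT f -> continuous f.
Proof.
move=> acf x; apply/cvgrPdist_lt => e e0; have [d d0 H] := acf e e0.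
near=> t.
have tx : `|x - t| < d by near: t; exact: cvgr_dist_lt.
have [h|h] := leP x t.
  have := H 1%N (fun=> x) (fun=> t); rewrite !big_ord1 distrC; apply => //.
  - by move=> k l; rewrite !ord1 eqxx.
  - by rewrite -(ger0_norm (x := t - x)) ?subr_ge0// distrC.
have := H 1%N (fun=> t) (fun=> x); rewrite !big_ord1; apply => //.
- by move=> k; exact: ltW.
- by move=> k l; rewrite !ord1 eqxx.
- by rewrite -(ger0_norm (x := x - t)) // subr_ge0 ltW.
Unshelve. all: by end_near. Qed.

Lemma abs_continuous_on_within a b f : a <= b -> abs_continuous_on `[a, b] f ->
  {within `[a, b], continuous f}.
Proof.
move=> ab acf; apply: (@subspace_eq_continuous _ _ _ (f \o clamp a b)).
  by move=> x; rewrite inE/= => xab; rewrite /from_subspace/= clamp_id.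
apply: continuous_subspaceT.
exact/abs_continuous_onT_continuous/abs_continuous_on_clamp.
Qed.

End ac_closure.

(** * Total variation of an absolutely continuous function *)

Section ac_total_variation.
Set Implicit Arguments.
Unset Strict Implicit.
Context {R : realType}.
Implicit Types (a b : R) (f : R -> R).
Local Notation TV := total_variation.

(** Absolute continuity with bound 1 makes the variation at most 1 on every segment shorter than
    some [d], and finitely many such segments cover [a, b]. *)
Lemma abs_continuous_on_bounded_variation a b f : a <= b ->
  abs_continuous_on `[a, b] f -> bounded_variation a b f.
Proof.
move=> ab /abs_continuous_on_segments /(_ ltr01)[d d0 acf].
have {}acf l : segments `[a, b] l -> total_length l < d -> sumvar f l <= 1.
  by move=> h1 h2; exact/ltW/acf.
have short u v : a <= u -> u <= v -> v <= b -> v - u < d -> (TV u v f <= 1)%E.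
  move=> au uv vb uvd.
  have := le_sum_total_variation (@interval_is_interval _ `[a, b]) acf
    (l1 := [:: (u, v)]) (l2 := [::]).
  rewrite big_seq1 /sumvar big_nil adde0; apply.
    2: by rewrite /total_length big_seq1.
  split => // p; rewrite inE => /eqP ->//=.
  by rewrite !in_itv/= au vb (le_trans au)// (le_trans uv).
apply/bounded_variationP => //.
have d20 : 0 < d / 2 by rewrite divr_gt0.
(* The induction cuts off a last piece of length [d / 2], strictly below [d] as [short] demands. *)
have long n : forall x, a <= x -> x <= b -> x - a <= n%:R * (d / 2) ->
    (TV a x f <= n%:R%:E)%E.
  elim: n => [|n IH] x ax xb.
    rewrite mul0r subr_le0 => xa; have -> : x = a by apply/le_anti; rewrite xa.
    by rewrite total_variationxx.
  rewrite -natr1 mulrDl mul1r => xn.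
  have [xa|xa] := leP (x - d / 2) a.
    apply: le_trans (short a x _ _ _ _) _ => //.
      by apply: le_lt_trans (_ : d / 2 < d); lra.
    by rewrite lee_fin lerDr.
  rewrite (@total_variationD _ _ _ (x - d / 2))//; [|exact: ltW|by lra].
  rewrite EFinD leeD//; [apply: IH; lra|apply: short; lra].
rewrite ge0_fin_numE ?total_variation_ge0//.
apply: le_lt_trans (ltry _).
  apply: (long (Num.truncn ((b - a) / (d / 2))).+1) => //.
by rewrite -ler_pdivrMr// ltW// truncnS_gt.
Qed.

Lemma total_variation_fineB a b f u v : bounded_variation a b f ->
  a <= u -> u <= v -> v <= b ->
  TV u v f = (fine (TV a v f) - fine (TV a u f))%:E.
Proof.
move=> bv au uv vb.
have av := le_trans au uv.
have bvv : bounded_variation a v f by exact: bounded_variationl bv.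
have bvu : bounded_variation a u f by exact: bounded_variationl bvv.
have buv : bounded_variation u v f by exact: bounded_variationr bvv.
move/bounded_variationP : bvv => /(_ av) /fineK fv.
move/bounded_variationP : bvu => /(_ au) /fineK fu.
move/bounded_variationP : buv => /(_ uv) /fineK fuv.
have := total_variationD f au uv; rewrite -fv -fu -fuv -EFinD => -[->].
by rewrite addrC addKr.
Qed.

(** The increment of the variation function over a segment is the total variation of [f] there, so
    [le_sum_total_variation] bounds the sum over a family with the same [d] as for [f]. *)
Lemma abs_continuous_on_total_variation a b f : a <= b ->
  abs_continuous_on `[a, b] f ->
  abs_continuous_on `[a, b] (fun x => fine (TV a x f)).
Proof.
move=> ab acf; have bv := abs_continuous_on_bounded_variation ab acf.
apply: segments_abs_continuous_on => e e0.
have [d d0 H] := abs_continuous_on_segments acf e0.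
exists d => // l sl ld.
have {}H k : segments `[a, b] k -> total_length k < d -> sumvar f k <= e.
  by move=> h1 h2; exact/ltW/H.
have := le_sum_total_variation (@interval_is_interval _ `[a, b]) H
    (l1 := l) (l2 := [::]).
rewrite cats0 => /(_ sl ld); rewrite {1}/sumvar big_nil adde0.
rewrite -lee_fin; apply: le_trans.
rewrite /sumvar -sumEFin le_eqVlt; apply/orP; left; apply/eqP.
rewrite big_seq [RHS]big_seq; apply: eq_bigr => p pl.
have [l1 l2 _] := sl; have [] := l2 _ pl; have := l1 _ pl.
rewrite /= !in_itv/= => p12 /andP[ap1 p1b] /andP[ap2 p2b].
rewrite (total_variation_fineB bv ap1 p12 p2b) ger0_norm//.
by rewrite -lee_fin -(total_variation_fineB bv)// total_variation_ge0.
Qed.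

Lemma total_variation_ge_diff a b f u v : bounded_variation a b f ->
  a <= u -> u <= v -> v <= b ->
  `|f v - f u| <= fine (TV a v f) - fine (TV a u f).
Proof.
move=> bv au uv vb; rewrite -lee_fin -(total_variation_fineB bv)//.
exact: total_variation_ge.
Qed.

Lemma abs_continuous_on_bounded a b f : a <= b -> abs_continuous_on `[a, b] f ->
  exists M, forall x, x \in `[a, b] -> `|f x| <= M.
Proof.
move=> ab acf; have bv := abs_continuous_on_bounded_variation ab acf.
exists (`|f a| + fine (TV a b f)) => x; rewrite in_itv/= => /andP[ax xb].
have := total_variation_ge_diff bv (lexx a) ax xb.
have := total_variation_ge_diff bv ax xb (lexx b).
rewrite total_variationxx/= subr0.
have := normr_ge0 (f b - f x); have := ler_normD (f x - f a) (f a).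
rewrite subrK; lra.
Qed.

End ac_total_variation.

(** * The fundamental theorem of calculus for absolutely continuous functions *)

Section stieltjes_dominated.
Set Implicit Arguments.
Unset Strict Implicit.
Context {R : realType}.
Local Notation mu := (@lebesgue_measure R).

Lemma open_interval_bounds (X : set R) : open X -> is_interval X ->
  (mu X < +oo)%E -> exists p : R * R,
  [/\ p.1 <= p.2, X = `]p.1, p.2[%classic & mu X = (p.2 - p.1)%:E].
Proof.
move=> oX iX Xoo.
have [->|/set0P[z Xz]] := eqVneq X set0.
  by exists (0, 0); rewrite /= subrr measure0 set_itvE.
have := iX; move/is_intervalP; case: (Rhull X) => -[c u|[]] [d v|[]] XE.
- have {}XE : X = `]u, v[%classic.
    by rewrite -(interior_itv_bnd u v c d) -XE ((interior_id X).1 oX).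
  have uv : u < v by move: Xz; rewrite XE/= in_itv/= => /andP[/lt_trans]; apply.
  exists (u, v) => /=; split => //; first exact: ltW.
  by rewrite XE lebesgue_measure_itv/= lte_fin uv.
- by move: Xz; rewrite XE/= in_itv/= andbF.
- by move: Xoo; rewrite XE lebesgue_measure_itv/= ltry.
- by move: Xoo; rewrite XE lebesgue_measure_itv/= ltNyr.
- by move: Xz; rewrite XE/= in_itv/=.
- by move: Xoo; rewrite XE lebesgue_measure_itv.
- by move: Xz; rewrite XE/= in_itv/=.
- by move: Xz; rewrite XE/= in_itv/=.
- by move: Xz; rewrite XE/= in_itv/=.
Qed.

Lemma lebesgue_stieltjes_measure_oc (G : cumulative R R) (u v : R) : u <= v ->
  lebesgue_stieltjes_measure G `]u, v]%classic = (G v - G u)%:E.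
Proof.
move=> uv; rewrite /lebesgue_stieltjes_measure /measure_extension.
by rewrite measurable_mu_extE/=; [rewrite wlength_itv_bnd|exact: is_ocitv].
Qed.

Lemma disjoint_oo_nonoverlapping (p q : R * R) : p.1 < p.2 -> q.1 < q.2 ->
  `]p.1, p.2[%classic `&` `]q.1, q.2[%classic = set0 -> nonoverlapping p q.
Proof.
move=> p12 q12 pq; rewrite /nonoverlapping.
have [//|q1p2] := leP p.2 q.1; have [//|p1q2] := leP q.2 p.1.
(* If the segments overlapped, the midpoint of their overlap would lie in both open intervals. *)
exfalso; suff : set0 ((Num.max p.1 q.1 + Num.min p.2 q.2) / 2) by [].
rewrite -pq; split; rewrite /= in_itv/= /Num.max /Num.min /Order.max /Order.min;
  by repeat case: ifPn; rewrite -?leNgt => *; apply/andP; split; lra.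
Qed.

(** A null set lies in an open set of Lebesgue measure below [d], which is a countable disjoint
    union of open intervals. Finitely many of these have total [G]-increment below [e], and the
    bound passes to the limit. *)
Lemma abs_continuous_on_stieltjes_dominated (G : cumulative R R) :
  abs_continuous_on setT G -> lebesgue_stieltjes_measure G `<< mu.
Proof.
move=> acG.
apply/null_content_dominatesP => A mA A0.
apply/eqP; rewrite eq_le measure_ge0 andbT; apply/lee_addgt0Pr => e e0.
rewrite add0e.
have [d d0 H] := abs_continuous_on_segments acG e0.
have Aoo : (mu A < +oo)%E by rewrite A0.
have [U [oU AU UAd]] := lebesgue_regularity_outer mA Aoo d0.
have mU : measurable (U : set (measurableTypeR R)) by exact: open_measurable.
have Ud : (mu U < d%:E)%E.
  rewrite (measureDI mu mU mA) [X in (_ + X)%E](_ : _ = 0%E) ?adde0//.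
  apply/eqP; rewrite -measure_le0 -A0; apply: le_measure; rewrite ?inE//.
  exact: measurableI.
pose I := open_disjoint_itv oU.
have oI k : open (I k) by exact: open_disjoint_itv_open.
have mI k : measurable (I k : set (measurableTypeR R)) by exact: open_measurable.
have UE : U = \bigcup_k I k := open_disjoint_itv_bigcup oU.
have trI : trivIset setT I by exact: open_disjoint_itv_trivIset.
have IU k : (mu (I k) <= mu U)%E.
  apply: le_measure; rewrite ?inE//.
  by rewrite UE; exact: bigcup_sup.
have /choice[p Hp] : forall k, exists p : R * R,
  [/\ p.1 <= p.2, I k = `]p.1, p.2[%classic & mu (I k) = (p.2 - p.1)%:E].
  move=> k; apply: open_interval_bounds => //.
    exact: open_disjoint_itv_is_interval.
  by rewrite (le_lt_trans (IU k))// (lt_le_trans Ud)// leey.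
apply: (@le_trans _ _ (lebesgue_stieltjes_measure G U)).
  by apply: le_measure; rewrite ?inE.
rewrite {1}UE.
apply: (@le_trans _ _
  (\sum_(0 <= k <oo) lebesgue_stieltjes_measure G (I k))%E).
  rewrite measure_bigcup// eseries_mkcond.
  by apply: lee_nneseries => // k _; case: ifPn.
apply: lime_le; first exact: is_cvg_nneseries.
apply: nearW => n.
(* Degenerate pairs are removed: their open interval is empty, so disjointness does not keep them
   from lying inside another segment. They contribute 0 to the sums, as [drop] records. *)
pose l := [seq p k | k <- iota 0 n & (p k).1 < (p k).2].
have drop (F : R * R -> R) : (forall q, q.1 = q.2 -> F q = 0) ->
    \sum_(q <- l) F q = \sum_(0 <= k < n) F (p k).
  move=> F0; rewrite /l big_map big_filter /index_iota subn0 big_mkcond/=.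
  apply: eq_bigr => k _; case: ifPn => //; rewrite -leNgt => h.
  by rewrite F0//; apply/le_anti; rewrite h; have [->] := Hp k.
have sl : segments setT l.
  split => //.
    by move=> q /mapP[k]; rewrite mem_filter => /andP[/ltW pk _] ->.
  rewrite pairwise_map.
  pose P := [pred k | (p k).1 < (p k).2].
  apply: (@sub_in_pairwise _ P (fun i j => i != j)).
  - move=> i j Pi Pj /= ij; apply: disjoint_oo_nonoverlapping => //.
    have [_ <- _] := Hp i; have [_ <- _] := Hp j.
    by move/trivIsetP : trI; apply.
  - exact: filter_all.
  - by rewrite -uniq_pairwise filter_uniq// iota_uniq.
have ll : total_length l < d.
  rewrite /total_length drop; last by move=> q ->; rewrite subrr.
  rewrite -lte_fin -sumEFin; apply: le_lt_trans Ud.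
  rewrite UE measure_bigcup//.
  rewrite [leRHS](_ : _ = \sum_(0 <= k <oo) mu (I k))%E; last first.
    by apply: eq_eseriesl => k; rewrite in_setT.
  rewrite (eq_bigr (fun k => mu (I k))); last first.
    by move=> k _; have [_ _ ->] := Hp k.
  exact: nneseries_lim_ge.
apply: le_trans (_ : (sumvar G l)%:E <= _)%E; last by rewrite lee_fin ltW// H.
rewrite /sumvar drop; last by move=> q ->; rewrite subrr normr0.
rewrite -sumEFin; apply: lee_sum => k _; have [pk Ik _] := Hp k.
rewrite ger0_norm; last by rewrite subr_ge0; exact: cumulative_is_nondecreasing.
rewrite -lebesgue_stieltjes_measure_oc//; apply: le_measure; rewrite ?inE//.
by rewrite Ik; exact: subset_itv_oo_oc.
Qed.

End stieltjes_dominated.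

(** * Densities and almost everywhere differentiation *)

Section ac_ftc.
Set Implicit Arguments.
Unset Strict Implicit.
Context {R : realType}.
Local Notation mu := (@lebesgue_measure R).
Implicit Types (a b : R) (f G : R -> R).

(** The density is the Radon-Nikodym derivative of the Stieltjes measure of [G], restricted to []a,
    b]] to be finite. Half-open intervals are those whose measure is the increment of [G]. *)
Lemma nondecreasing_abs_continuous_density a b G : a <= b ->
  {homo G : x y / x <= y} -> abs_continuous_on setT G ->
  exists2 g : R -> R, mu.-integrable setT (EFin \o g) &
    forall x, x \in `[a, b] -> G x - G a = \int[mu]_(t in `]a, x]) g t.
Proof.
move=> ab ndG acG.
have rcG : right_continuous G.
  exact/right_continuousW/abs_continuous_onT_continuous.
pose GC := isCumulative.Build R _ R G ndG rcG.
pose Gc : cumulative R R := HB.pack G GC.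
have dom := @abs_continuous_on_stieltjes_dominated R Gc acG.
have mab : measurable (`]a, b]%classic : set (measurableTypeR R)).
  exact: (measurable_itv (Interval (BRight _) (BRight _))).
have fin : (lebesgue_stieltjes_measure Gc `]a, b]%classic < +oo)%E.
  by rewrite lebesgue_stieltjes_measure_oc// ltry.
pose nu := mfrestr mab fin.
have domnu : nu `<< mu.
  apply/null_content_dominatesP => A mA A0.
  move/null_content_dominatesP : dom; apply; first exact: measurableI.
  apply/eqP; rewrite -measure_le0 -A0.
  by apply: le_measure; rewrite ?inE//; exact: measurableI.
have [g [g0 gfin intg gE]] := @radon_nikodym_sigma_finite _ _ _ mu nu domnu.
have gK : EFin \o (fine \o g) = g by apply/funext => x /=; rewrite fineK.
exists (fine \o g); first by rewrite gK.
move=> x; rewrite in_itv/= => /andP[ax xb].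
rewrite /Rintegral (_ : (fun t => _) = g); last by rewrite -[RHS]gK.
rewrite -gE; last exact: (measurable_itv (Interval (BRight _) (BRight _))).
have nuE : nu `]a, x]%classic = (G x - G a)%:E.
  rewrite /nu /mfrestr /mrestr setIidl.
    by rewrite lebesgue_stieltjes_measure_oc.
  by move=> t; rewrite /= !in_itv/= => /andP[-> /le_trans]; apply.
exact: (congr1 fine (esym nuE)).
Qed.

Lemma abs_continuous_on_density a b f : a <= b -> abs_continuous_on `[a, b] f ->
  exists2 g : R -> R, mu.-integrable setT (EFin \o g) &
    forall x, x \in `[a, b] -> f x - f a = \int[mu]_(t in `]a, x]) g t.
Proof.
move=> ab acf; have bv := abs_continuous_on_bounded_variation ab acf.
pose V x := fine (total_variation a x f).
have acV : abs_continuous_on `[a, b] V.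
  exact: abs_continuous_on_total_variation.
have acVf := abs_continuous_onB acV acf.
(* This single bound makes both [V] and [V - f], extended by [clamp], nondecreasing; the density of
   [f] is the difference of theirs. *)
have diff x y : x <= y -> `|f (clamp a b y) - f (clamp a b x)| <=
    V (clamp a b y) - V (clamp a b x).
  move=> xy; have := clamp_itv x ab; have := clamp_itv y ab; rewrite !in_itv/=.
  move=> /andP[? ?] /andP[? ?]; apply: (total_variation_ge_diff bv) => //.
  exact: clamp_le.
have [x y xy|gV iV gVE] := nondecreasing_abs_continuous_density ab _
    (abs_continuous_on_clamp ab acV).
  by rewrite -subr_ge0; apply: le_trans (diff _ _ xy).
have [x y xy|gW iW gWE] := nondecreasing_abs_continuous_density ab _
    (abs_continuous_on_clamp ab acVf).
  rewrite -subr_ge0 /=; have := diff _ _ xy.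
  have := ler_norm (f (clamp a b y) - f (clamp a b x)); lra.
exists (gV \- gW); first exact: (integrableB measurableT iV iW).
move=> x xab; have aab : a \in `[a, b] by rewrite in_itv/= lexx.
rewrite RintegralB//.
- by rewrite -gVE// -gWE//= !clamp_id//; ring.
- exact: integrableS iV.
- exact: integrableS iW.
Qed.

Theorem abs_continuous_on_FTC a b f : a <= b -> abs_continuous_on `[a, b] f ->
  exists g : R -> R, [/\ mu.-integrable setT (EFin \o g),
    {ae mu, forall x, x \in `]a, b[ -> is_derive x 1 f (g x)} &
    f b - f a = \int[mu]_(t in `[a, b]) g t].
Proof.
move=> ab acf; have [g ig gE] := abs_continuous_on_density ab acf.
exists g; split => //; last first.
  rewrite gE; last by rewrite in_itv/= lexx ab.
  by apply: Rintegral_itv_obnd_cbnd; exact: integrableS ig.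
have locg : locally_integrable setT g by exact: open_integrable_locally openT ig.
have igy y : mu.-integrable [set` Interval (BRight a) (BRight y)] (EFin \o g).
  exact: integrableS ig.
have := @FTC1 R g (BRight a) igy locg.
apply: filterS; first exact: (ae_filter_ringOfSetsType mu).
move=> x /= H xab.
have [ax xb] : a < x /\ x < b by move: xab; rewrite in_itv/= => /andP[].
have [|dF <-] := H; first by [].
(* Near an interior point, [f] is the indefinite integral of [g] plus the constant [f a], so
   Lebesgue differentiation applies to it. *)
apply: (@near_eq_is_derive _ _ _
  ((fun y => \int[mu]_(t in `]a, y]) g t) + cst (f a))).
  near=> y; rewrite fctE -gE ?subrK//.
  by apply: subset_itv_oo_cc; near: y; exact: near_in_itvoo.
rewrite -[X in is_derive _ _ _ X]addr0; apply: is_deriveD.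
by rewrite derive1E; exact: derivableP.
Unshelve. all: by end_near. Qed.

End ac_ftc.

(** * The inequality *)

Section inequality.
Set Implicit Arguments.
Unset Strict Implicit.
Context {R : realType}.
Local Notation mu := (@lebesgue_measure R).
Implicit Types (a b u v : R) (f g : R -> R).

(** The difference [g - f] agrees almost everywhere with its absolute value, whose integral is
    nonnegative. *)
Lemma ae_le_Rintegral (D : set (measurableTypeR R)) f g : measurable D ->
  mu.-integrable D (EFin \o f) -> mu.-integrable D (EFin \o g) ->
  {ae mu, forall x, D x -> f x <= g x} ->
  \int[mu]_(x in D) f x <= \int[mu]_(x in D) g x.
Proof.
move=> mD fi gi fg; rewrite -subr_ge0 -RintegralB//.
have gfi : mu.-integrable D (EFin \o (g \- f)) by exact: (integrableB mD gi fi).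
have mgf := measurable_int mu gfi.
rewrite /Rintegral (@ae_eq_integral _ (measurableTypeR R) R mu D
  (fun x : measurableTypeR R => `|(g x - f x)%:E|%E))//.
- by apply: fine_ge0; apply: integral_ge0.
- exact: measurableT_comp.
- have F := ae_filter_ringOfSetsType mu.
  by apply: filterS fg => x fgx Dx; rewrite /= ger0_norm// subr_ge0 fgx.
Qed.

Lemma abs_continuous_onM_itv u v f g : u <= v ->
  abs_continuous_on `[u, v] f -> abs_continuous_on `[u, v] g ->
  abs_continuous_on `[u, v] (f \* g).
Proof.
move=> uv acf acg.
have [M fM] := abs_continuous_on_bounded uv acf.
have [N gN] := abs_continuous_on_bounded uv acg.
apply: (@abs_continuous_onM _ _ _ _ (Num.max M N)) => // x xuv.
- by rewrite le_max fM.
- by rewrite le_max gN ?orbT.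
Qed.

(* A primitive of 2 lam f' p + 2 lam f - lam^2 p^2, where p t = t - m, which is
   below f'^2 + 2 lam f because (f' - lam p)^2 >= 0. *)
Definition corrector lam m f t :=
  2 * lam * f t * (t - m) - lam ^+ 2 / 3 * (t - m) ^+ 3.

Lemma abs_continuous_on_corrector u v f lam m : u <= v ->
  abs_continuous_on `[u, v] f -> abs_continuous_on `[u, v] (corrector lam m f).
Proof.
move=> uv acf; pose p := @idfun R \- cst m.
have acp : abs_continuous_on `[u, v] p.
  by apply: abs_continuous_onB;
    [exact: abs_continuous_on_id|exact: abs_continuous_on_cst].
have -> : corrector lam m f =
    ((cst (2 * lam) \* f) \* p) \- (cst (lam ^+ 2 / 3) \* (p \* (p \* p))).
  by apply/funext => t; rewrite /corrector /p /=; ring.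
by apply: abs_continuous_onB; do ?[exact: abs_continuous_on_cst | exact: acf
  | exact: acp | apply: abs_continuous_onM_itv => //].
Qed.

Lemma is_derive_corrector f lam m (t d : R) : is_derive t 1 f d ->
  is_derive t 1 (corrector lam m f)
    (2 * lam * d * (t - m) + 2 * lam * f t - lam ^+ 2 * (t - m) ^+ 2).
Proof.
move=> df; pose p := @idfun R - cst m.
have dp : is_derive t 1 p 1.
  by apply: is_derive_eq; rewrite subr0.
have -> : corrector lam m f = (2 * lam) *: (f * p) - (lam ^+ 2 / 3) *: (p ^+ 3).
  apply/funext => x; rewrite /corrector /p !fctE /=.
  by rewrite /GRing.scale/= !mulrA.
apply: is_derive_eq.
rewrite /p !fctE /= /GRing.scale/=.
by field.
Qed.

(** The fundamental theorem applied to the corrector does the work of integration by parts; its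
    derivative falls short of the integrand by the square of [f' - lam (t - m)]. *)
Lemma corrector_increment_le u v f lam m : u <= v ->
  abs_continuous_on `[u, v] f ->
  mu.-integrable `[u, v] (EFin \o (fun t => derive1 f t ^+ 2)) ->
  corrector lam m f v - corrector lam m f u <=
    \int[mu]_(t in `[u, v]) (derive1 f t ^+ 2 + 2 * lam * f t).
Proof.
move=> uv acf if2.
have [g [ig dg _]] := abs_continuous_on_FTC uv acf.
have [h [ih dh ->]] :=
  abs_continuous_on_FTC uv (abs_continuous_on_corrector lam m uv acf).
have iff : mu.-integrable `[u, v] (EFin \o f).
  apply: continuous_compact_integrable; first exact: segment_compact.
  exact: abs_continuous_on_within.
have ik : mu.-integrable `[u, v]
    (EFin \o (fun t => derive1 f t ^+ 2 + 2 * lam * f t)).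
  exact: (integrableD _ if2 (integrableZl _ (2 * lam) iff)).
(* Derivatives are known only at interior points, so the comparison is made on the open interval,
   which has the same integrals. *)
have sub : `]u, v[%classic `<=` `[u, v]%classic by exact: subset_itv_oo_cc.
have muv : measurable (`]u, v[%classic : set (measurableTypeR R)).
  exact: (measurable_itv (Interval (BRight _) (BLeft _))).
have ih' : mu.-integrable `]u, v[ (EFin \o h) by exact: integrableS ih.
have ik' : mu.-integrable `]u, v[
    (EFin \o (fun t => derive1 f t ^+ 2 + 2 * lam * f t)).
  exact: integrableS ik.
have toopen (k : R -> R) : mu.-integrable `]u, v[ (EFin \o k) ->
    \int[mu]_(t in `[u, v]) k t = \int[mu]_(t in `]u, v[) k t.
  by move=> ki; congr fine; apply: integral_itv_bndoo; exact: measurable_int ki.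
rewrite (toopen _ ih') (toopen _ ik').
apply: ae_le_Rintegral => //.
have F := ae_filter_ringOfSetsType mu.
apply: filterS2 dg dh => t dg dh tuv.
have df := dg tuv; have {}dh := dh tuv.
have := @is_derive_corrector _ lam m _ _ df => dc.
have -> : h t = 2 * lam * g t * (t - m) + 2 * lam * f t - lam ^+ 2 * (t - m) ^+ 2.
  by rewrite -(@derive_val _ _ _ _ _ _ _ dh) (@derive_val _ _ _ _ _ _ _ dc).
have -> : derive1 f t = g t by rewrite derive1E (@derive_val _ _ _ _ _ _ _ df).
rewrite -subr_ge0; have := sqr_ge0 (g t - lam * (t - m)).
by congr (0 <= _); ring.
Qed.

(** A point strictly between [a] and [b] has []a, b[] as a neighbourhood, and this lies in [I] by
    convexity. *)
Lemma interior_interval_segment (I : set R) a b : is_interval I ->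
  interior I a -> interior I b -> `[a, b]%classic `<=` interior I.
Proof.
move=> iI Ia Ib x; rewrite /= in_itv/= => /andP[].
rewrite le_eqVlt => /predU1P[<- //|ax].
rewrite le_eqVlt => /predU1P[-> //|xb].
have : \forall y \near x, y \in `]a, b[.
  by apply: near_in_itvoo; rewrite in_itv/= ax.
apply: filterS => y; rewrite in_itv/= => /andP[/ltW ay /ltW yb].
by apply: (iI a b); [exact: interior_subset..|rewrite ay].
Qed.

Lemma periodic_mean0_sqr_le a b f x : a < b -> abs_continuous_on `[a, b] f ->
  mu.-integrable `[a, b] (EFin \o (fun t => derive1 f t ^+ 2)) ->
  f a = f b -> \int[mu]_(t in `[a, b]) f t = 0 -> x \in `[a, b] ->
  f x ^+ 2 <= (b - a) / 12 * \int[mu]_(t in `[a, b]) (derive1 f t ^+ 2).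
Proof.
move=> ab acf if2 fab intf; rewrite in_itv/= => /andP[ax xb].
have L0 : b - a != 0 by rewrite gt_eqF// subr_gt0.
(* With L = b - a, the two corrector increments below add up to 2 lam (f x) L - lam^2 L^3 / 12. This
   [lam] maximizes that sum, with maximum 12 (f x)^2 / L. *)
pose lam := 12 * f x / (b - a) ^+ 2.
pose k t := derive1 f t ^+ 2 + 2 * lam * f t.
have iff : mu.-integrable `[a, b] (EFin \o f).
  apply: continuous_compact_integrable; first exact: segment_compact.
  exact/abs_continuous_on_within/acf/ltW.
have ilf : mu.-integrable `[a, b] (EFin \o (fun t => 2 * lam * f t)).
  exact: (integrableZl _ (2 * lam) iff).
have ik : mu.-integrable `[a, b] (EFin \o k) by exact: (integrableD _ if2 ilf).
have kE : \int[mu]_(t in `[a, b]) k t =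
    \int[mu]_(t in `[a, b]) (derive1 f t ^+ 2).
  by rewrite RintegralD// RintegralZl// intf mulr0 addr0.
have sl : `[a, x]%classic `<=` `[a, b]%classic.
  by apply: subset_itvl; rewrite bnd_simp.
have sr : `[x, b]%classic `<=` `[a, b]%classic.
  by apply: subset_itvr; rewrite bnd_simp.
have ikr : mu.-integrable `]x, b] (EFin \o k).
  apply: integrableS ik => //; apply: subset_trans sr; exact: subset_itv_oc_cc.
have split : \int[mu]_(t in `[a, b]) k t =
    \int[mu]_(t in `[a, x]) k t + \int[mu]_(t in `[x, b]) k t.
  rewrite -(Rintegral_itv_obnd_cbnd ikr) -(Rintegral_itvB ik) ?bnd_simp//.
  by rewrite addrC subrK.
have if2l : mu.-integrable `[a, x] (EFin \o (fun t => derive1 f t ^+ 2)).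
  exact: integrableS if2.
have if2r : mu.-integrable `[x, b] (EFin \o (fun t => derive1 f t ^+ 2)).
  exact: integrableS if2.
(* The two centres differ by b - a, so t - m takes the same value at [a] on the left piece as at [b]
   on the right one. Since [f a = f b], these boundary terms cancel and only those at [x] remain. *)
have Hl := corrector_increment_le lam (x - (b - a) / 2) ax
  (abs_continuous_onS sl acf) if2l.
have Hr := corrector_increment_le lam (x + (b - a) / 2) xb
  (abs_continuous_onS sr acf) if2r.
have {Hl Hr} := lerD Hl Hr; rewrite -/k -split kE.
set J := Rintegral _ _ _; rewrite /corrector -fab => HJ.
rewrite mulrC -ler_pdivrMr; last by rewrite divr_gt0// subr_gt0.
apply: le_trans HJ; rewrite le_eqVlt; apply/orP; left; apply/eqP.
rewrite /lam; field.
by rewrite L0.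
Qed.

End inequality.

(** * Sharpness *)

Section sharpness.
Set Implicit Arguments.
Unset Strict Implicit.
Context {R : realType}.
Local Notation mu := (@lebesgue_measure R).
Implicit Types (a b : R) (f g : R -> R).

Lemma integral_is_derive a b (F g : R -> R) : a < b -> continuous g ->
  (forall t : R, is_derive t 1 F (g t)) ->
  (\int[mu]_(t in `[a, b]) (g t)%:E = (F b - F a)%:E)%E.
Proof.
move=> ab cg dF; rewrite (@continuous_FTC2 _ g F)//.
- exact: continuous_subspaceT.
- have cF : continuous F.
    move=> t; apply: differentiable_continuous; apply/derivable1_diffP.
    by have [] := dF t.
  split.
  + by move=> t _; have [] := dF t.
  + by apply: cvg_at_right_filter; exact: cF.
  + by apply: cvg_at_left_filter; exact: cF.
- by move=> t _; rewrite derive1E; apply: derive_val.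
Qed.

(** A rescaled second Bernoulli polynomial; the constant subtracted is the mean of the quadratic
    term over [a, b]. *)
Definition parabola a b t := (t - (a + b) / 2) ^+ 2 / 2 - (b - a) ^+ 2 / 24.

(* Truncating the parabola outside [a, b] makes it Lipschitz on the whole line. *)
Definition extremal a b t := parabola a b (clamp a b t).

Lemma clamp_dist_norm a b x y : `|clamp a b y - clamp a b x| <= `|y - x|.
Proof.
wlog xy : x y / x <= y.
  by move=> H; have [/H//|/ltW/H] := leP x y; rewrite distrC (distrC x).
by rewrite !ger0_norm ?subr_ge0 ?clamp_le// clamp_dist.
Qed.

Lemma abs_continuous_on_extremal (D : set R) a b : a < b ->
  abs_continuous_on D (extremal a b).
Proof.
move=> ab; apply: (@abs_continuous_on_lipschitz _ _ _ (b - a)); first by lra.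
move=> x y _ _; rewrite /extremal /parabola.
apply: le_trans (_ : (b - a) * `|clamp a b y - clamp a b x| <= _); last first.
  by apply: ler_wpM2l; [lra|exact: clamp_dist_norm].
have := clamp_itv x (ltW ab); have := clamp_itv y (ltW ab); rewrite !in_itv/=.
set p := clamp a b x; set q := clamp a b y => /andP[? ?] /andP[? ?].
rewrite [X in `|X| <= _](_ : _ = (p + q - (a + b)) / 2 * (q - p)); last by field.
rewrite normrM ler_wpM2r// ler_norml; apply/andP; split; lra.
Qed.

(** The endpoints are left out because the truncation creates kinks there. *)
Lemma is_derive_extremal a b t : t \in `]a, b[ ->
  is_derive t 1 (extremal a b) (t - (a + b) / 2).
Proof.
move=> tab; apply: (@near_eq_is_derive _ _ _ (parabola a b)).
  near=> y; rewrite /extremal clamp_id//.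
  by apply: subset_itv_oo_cc; near: y; exact: near_in_itvoo.
have -> : parabola a b =
    2^-1 *: ((@idfun R - cst ((a + b) / 2)) ^+ 2) - cst ((b - a) ^+ 2 / 24).
  by apply/funext => y; rewrite /parabola !fctE /= /GRing.scale/= mulrC.
apply: is_derive_eq; rewrite !fctE /= /GRing.scale/=.
by field.
Unshelve. all: by end_near. Qed.

Lemma derive1_extremal a b t : t \in `]a, b[ ->
  derive1 (extremal a b) t = t - (a + b) / 2.
Proof. by move=> /is_derive_extremal ?; rewrite derive1E; exact: derive_val. Qed.

(** Serves to ignore the values of [derive1 (extremal a b)] at the two kinks. *)
Lemma eq_integral_itvoo a b f g : continuous g -> {in `]a, b[, f =1 g} ->
  (\int[mu]_(t in `[a, b]) (f t)%:E = \int[mu]_(t in `[a, b]) (g t)%:E)%E.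
Proof.
move=> cg fg.
have mg : measurable_fun `]a, b[ g.
  by apply: measurable_funTS; exact: continuous_measurable_fun.
apply: eq_integral_itv_bounded => //.
by apply: eq_measurable_fun mg => t; rewrite inE/= => tab; rewrite fg.
Qed.

Lemma continuous_subr_cst (c : R) : continuous (fun t : R => t - c).
Proof. by move=> t; apply: cvgB; [exact: cvg_id|exact: cvg_cst]. Qed.

Lemma continuous_sqr_subr_cst (c : R) : continuous (fun t : R => (t - c) ^+ 2).
Proof.
move=> t; apply: (@continuous_comp _ _ _ (fun y => y - c) (fun z => z ^+ 2)).
  exact: continuous_subr_cst.
exact: exprn_continuous.
Qed.

Lemma integrable_derive1_extremal a b :
  mu.-integrable `[a, b] (EFin \o derive1 (extremal a b)).
Proof.
pose g (t : R) := t - (a + b) / 2.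
have cg : continuous g by exact: continuous_subr_cst.
have dg : {in `]a, b[, derive1 (extremal a b) =1 g} by move=> t /derive1_extremal.
apply/integrableP; split.
  apply/measurable_EFinP; apply: (@measurable_fun_itv_cc _ a b false true).
  apply: (@eq_measurable_fun _ _ _ _ _ g).
    by move=> t; rewrite inE/= => tab; rewrite dg.
  by apply: measurable_funTS; exact: continuous_measurable_fun.
have : mu.-integrable `[a, b] (EFin \o g).
  apply: continuous_compact_integrable; first exact: segment_compact.
  exact: continuous_subspaceT.
move=> /integrableP[_]; apply: le_lt_trans.
rewrite (@eq_integral_itvoo a b (fun t => `|derive1 (extremal a b) t|)
  (fun t => `|g t|))//.
- by move=> t; apply: cvg_norm; exact: cg.
- by move=> t /dg /= ->.
Qed.

Lemma integral_extremal a b : a < b ->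
  (\int[mu]_(t in `[a, b]) (extremal a b t)%:E = 0)%E.
Proof.
move=> ab.
pose F (t : R) : R := (t - (a + b) / 2) ^+ 3 / 6 - (b - a) ^+ 2 / 24 * t.
have cP : continuous (parabola a b).
  move=> t; apply: cvgB; last exact: cvg_cst.
  by apply: cvgMl; exact: continuous_sqr_subr_cst.
rewrite (eq_integral_itvoo cP); last first.
  by move=> t /subset_itv_oo_cc tab; rewrite /extremal clamp_id.
have dF (t : R) : is_derive t 1 F (parabola a b t).
  have -> : F = 6^-1 *: ((@idfun R - cst ((a + b) / 2)) ^+ 3) -
      ((b - a) ^+ 2 / 24) *: @idfun R.
    by apply/funext => y; rewrite /F !fctE /= /GRing.scale/= mulrC.
  apply: is_derive_eq; rewrite /parabola !fctE /= /GRing.scale/=.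
  by field.
by rewrite (integral_is_derive ab cP dF); congr EFin; rewrite /F; field.
Qed.

Lemma integral_derive1_extremal_sqr a b : a < b ->
  (\int[mu]_(t in `[a, b]) (derive1 (extremal a b) t ^+ 2)%:E =
   ((b - a) ^+ 3 / 12)%:E)%E.
Proof.
move=> ab; pose F (t : R) : R := (t - (a + b) / 2) ^+ 3 / 3.
have cg := @continuous_sqr_subr_cst ((a + b) / 2).
have dF (t : R) : is_derive t 1 F ((t - (a + b) / 2) ^+ 2).
  have -> : F = 3^-1 *: ((@idfun R - cst ((a + b) / 2)) ^+ 3).
    by apply/funext => y; rewrite /F !fctE /= /GRing.scale/= mulrC.
  apply: is_derive_eq; rewrite !fctE /= /GRing.scale/=.
  by field.
rewrite (eq_integral_itvoo cg); last by move=> t /derive1_extremal ->.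
by rewrite (integral_is_derive ab cg dF); congr EFin; rewrite /F; field.
Qed.

End sharpness.

Theorem theorem5 (R : realType) :
  (* the inequality *)
  (forall (I : set R) (f : R -> R) (a b : R),
     is_interval I ->
     abs_continuous_on (interior I) f ->
     interior I a -> interior I b -> a < b ->
     (@lebesgue_measure R).-integrable `[a, b] (EFin \o (derive1 f)) ->
     (forall x, x \in `[a, b] -> f x <= f a) ->
     f a = f b ->
     (\int[@lebesgue_measure R]_(t in `[a, b]) (f t)%:E = 0)%E ->
     forall x, x \in `[a, b] ->
       ((f x ^+ 2)%:E <=
         ((b - a) / 12)%:E * \int[@lebesgue_measure R]_(t in `[a, b]) ((derive1 f t) ^+ 2)%:E)%E)
  /\
  (* the constant (b - a)/12 is best possible *)
  (forall (I : set R) (a b : R),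
     is_interval I -> interior I a -> interior I b -> a < b ->
     forall c : R, c < (b - a) / 12 ->
     exists f : R -> R,
       [/\ abs_continuous_on (interior I) f,
           (@lebesgue_measure R).-integrable `[a, b] (EFin \o (derive1 f)),
           (forall x, x \in `[a, b] -> f x <= f a) /\ f a = f b,
           (\int[@lebesgue_measure R]_(t in `[a, b]) (f t)%:E = 0)%E &
           (exists2 x, x \in `[a, b] &
             (c%:E * \int[@lebesgue_measure R]_(t in `[a, b]) ((derive1 f t) ^+ 2)%:E
                < (f x ^+ 2)%:E)%E)]).
Proof.
split=> [I f a b iI acf Ia Ib ab if1 _ fab f0 x xab|I a b iI Ia Ib ab c cL].
- have L0 : 0 < (b - a) / 12 by rewrite divr_gt0// subr_gt0.
  have acab := abs_continuous_onS (interior_interval_segment iI Ia Ib) acf.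
  have mf2 : measurable_fun (`[a, b]%classic : set (measurableTypeR R))
      (fun t => derive1 f t ^+ 2).
    by apply: measurable_funX; apply/measurable_EFinP; exact: measurable_int if1.
  (* Only [f'] is assumed integrable, so its square may have infinite integral; the right-hand side
     is then infinite because the constant is positive. *)
  have [Jfin|] := boolP ((\int[@lebesgue_measure R]_(t in `[a, b])
      (derive1 f t ^+ 2)%:E)%E \is a fin_num).
    rewrite -(fineK Jfin) -EFinM lee_fin; apply: periodic_mean0_sqr_le => //.
      apply/integrableP; split; first exact/measurable_EFinP.
      by rewrite integral_fin_num_abs.
    by rewrite /Rintegral f0.
  rewrite ge0_fin_numE; last first.
    by apply: integral_ge0 => t _; rewrite lee_fin sqr_ge0.
  by rewrite ltey negbK => /eqP ->; rewrite gt0_muley ?leey// lte_fin.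
- exists (extremal a b).
  have aab : a \in `[a, b] by rewrite in_itv/= lexx ltW.
  have bab : b \in `[a, b] by rewrite in_itv/= lexx ltW.
  split.
  + exact: abs_continuous_on_extremal.
  + exact: integrable_derive1_extremal.
  + rewrite /extremal /parabola !clamp_id//; split; last by field.
    move=> x xab; rewrite clamp_id//; move: xab; rewrite in_itv/= => /andP[ax xb].
    (* Half of the product (x - a)(b - x) is exactly the value at [a] minus the value at [x]. *)
    have := mulr_ge0 (_ : 0 <= x - a) (_ : 0 <= b - x).
    rewrite !subr_ge0 => /(_ ax xb).
    nra.
  + exact: integral_extremal.
  (* With L = b - a, the value at [a] is L^2 / 8 - L^2 / 24 = L^2 / 12, whose square is L / 12 times
     the integral L^3 / 12. Equality holds for L / 12, so a smaller [c] fails. *)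
  + exists a => //; rewrite integral_derive1_extremal_sqr// -EFinM lte_fin.
    rewrite /extremal /parabola clamp_id//.
    have L3 : 0 < (b - a) ^+ 3 / 12 by rewrite divr_gt0// exprn_gt0// subr_gt0.
    rewrite -(ltr_pM2r L3) in cL; apply: lt_le_trans cL _.
    by rewrite le_eqVlt; apply/orP; left; apply/eqP; field.
Qed.
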